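(* Let $\ell\in\mathbb{N}_{\ge1}$ and $w_1,\ldots,w_\ell\in\mathbf{F}_r$. Then for large enough $n$ (namely, for every $n\ge\max_{x\in B}L_x$), the quantity $\mathcal{T}r_{w_1,\ldots,w_\ell}(n)$ is given by a rational expression in $n$ with rational coefficients, namely, by an element of $\mathbb{Q}(n)$.
   Context: $\mathbf{F}_r$ is the free group with fixed basis $B=\{x_1,\ldots,x_r\}$, and $\mathcal{U}(n)$ is the group of $n\times n$ unitary matrices. For $w\in\mathbf{F}_r$, $w(A_1,\ldots,A_r)$ is obtained by substituting $A_i$ for $x_i$. For $w_1,\ldots,w_\ell\in\mathbf{F}_r$, $$\mathcal{T}r_{w_1,\ldots,w_\ell}(n)=\int_{A_1,\ldots,A_r\in\mathcal{U}(n)}\mathrm{tr}(w_1(A_1,\ldots,A_r))\cdots\mathrm{tr}(w_\ell(A_1,\ldots,A_r))\,d\mu,$$ where $A_1,\ldots,A_r$ are independent Haar-random unitary matrices. $L_x$ is the total number of occurrences of $x^{+1}$ in the (reduced) words $w_1,\ldots,w_\ell$. Here $n$ ranges over positive integers; a single element of $\mathbb{Q}(n)$, depending only on $w_1,\ldots,w_\ell$, gives the value for all such $n$. *)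

(* Defs.v *)
From HB Require Import structures.
From mathcomp Require Import all_boot all_order all_algebra fraction.
From mathcomp Require Import complex.
From mathcomp Require Import all_classical all_reals all_analysis.
Import Order.TTheory GRing.Theory Num.Theory.
Import numFieldNormedType.Exports.

Set Implicit Arguments.
Unset Strict Implicit.
Unset Printing Implicit Defensive.

Local Open Scope classical_set_scope.
Local Open Scope ring_scope.
Local Open Scope complex_scope.

(* An element of the free group with basis x_0, ..., x_(r-1) is represented by
   its reduced word, the letter (i, true) standing for x_i and (i, false) for
   its inverse. *)
Definition reduced (r : nat) (s : seq ('I_r * bool)) : bool :=
  sorted (fun a b => ~~ ((a.1 == b.1) && (a.2 != b.2))) s.

Definition free_group (r : nat) : Type :=
  {s : seq ('I_r * bool) | reduced s}.

Definition pos_occurrences (r l : nat) (w : l.-tuple (free_group r))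
    (x : 'I_r) : nat :=
  (\sum_(k < l) count_mem (x, true) (val (tnth w k)))%N.

Section unitary_group.
Variables (R : realType) (n : nat).

Definition unitary : Type := {M : 'M[R[i]]_n | M \is unitarymx}.

HB.instance Definition _ := SubType.on unitary.
HB.instance Definition _ := Choice.on unitary.

Fact unitary_one_subproof : (1%:M : 'M[R[i]]_n) \is unitarymx.
Proof. by apply/unitarymxP; rewrite trmx1 map_mx1 mulmx1. Qed.

Fact unitary_mul_subproof (A B : unitary) : val A *m val B \is unitarymx.
Proof. exact: mul_unitarymx (valP A) (valP B). Qed.

Fact unitary_inv_subproof (A : unitary) : invmx (val A) \is unitarymx.
Proof.
by rewrite (invmx_unitary (valP A)) trmxC_unitary; exact: (valP A).
Qed.

Definition unitary_one : unitary := Sub 1%:M unitary_one_subproof.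
Definition unitary_mul (A B : unitary) : unitary :=
  Sub (val A *m val B) (unitary_mul_subproof A B).
Definition unitary_inv (A : unitary) : unitary :=
  Sub (invmx (val A)) (unitary_inv_subproof A).

Fact unitary_mulA : associative unitary_mul.
Proof. by move=> A B C; apply: val_inj; rewrite /= mulmxA. Qed.
Fact unitary_mul1 : left_id unitary_one unitary_mul.
Proof. by move=> A; apply: val_inj; rewrite /= mul1mx. Qed.
Fact unitary_mulr1 : right_id unitary_one unitary_mul.
Proof. by move=> A; apply: val_inj; rewrite /= mulmx1. Qed.
Fact unitary_mulV : left_inverse unitary_one unitary_inv unitary_mul.
Proof.
by move=> A; apply: val_inj; rewrite /= mulVmx// unitarymx_unit// (valP A).
Qed.
Fact unitary_mulrV : right_inverse unitary_one unitary_inv unitary_mul.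
Proof.
by move=> A; apply: val_inj; rewrite /= mulmxV// unitarymx_unit// (valP A).
Qed.

HB.instance Definition _ := isGroup.Build unitary
  unitary_mulA unitary_mul1 unitary_mulr1 unitary_mulV unitary_mulrV.

HB.instance Definition _ := isPointed.Build unitary unitary_one.

(* [R[i]^o] is R[i] with the topology of its norm. *)
HB.instance Definition _ := Topological.copy unitary
  (initial_topology (fun A : unitary => val A : 'M[R[i]^o]_n)).

HB.instance Definition _ := Measurable.copy unitary
  (g_sigma_algebraType (@open unitary)).

End unitary_group.

Section trace_integral.
Variables (R : realType) (n r : nat).

(* Normalised left-invariant Borel measure; [unitary R n] being a compact group,
   exactly one such probability exists and it is also right-invariant. *)
Definition haar_probability (mu : probability (unitary R n) R) : Prop :=
  forall (g : unitary R n) (B : set (unitary R n)), measurable B ->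
    mu [set (g * A)%g | A in B] = mu B.

(* [nu] is the joint law of r independent Haar-distributed unitary matrices,
   i.e. the product of r copies of the Haar probability measure. *)
Definition independent_haar
    (nu : probability (r.-tuple (unitary R n)) R) : Prop :=
  exists2 mu : probability (unitary R n) R, haar_probability mu &
    forall B : 'I_r -> set (unitary R n), (forall i, measurable (B i)) ->
      nu [set A | forall i, B i (tnth A i)] = (\prod_(i < r) mu (B i))%E.

Definition word_eval (w : free_group r) (A : r.-tuple (unitary R n)) :
    unitary R n :=
  (\prod_(a <- val w) (if a.2 then tnth A a.1 else (tnth A a.1)^-1))%g.

Definition complex_integral (nu : probability (r.-tuple (unitary R n)) R)
    (f : r.-tuple (unitary R n) -> R[i]) : R[i] :=
  (\int[nu]_A complex.Re (f A)) +i* (\int[nu]_A complex.Im (f A)).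

Definition trace_integral (nu : probability (r.-tuple (unitary R n)) R)
    (l : nat) (w : l.-tuple (free_group r)) : R[i] :=
  complex_integral nu
    (fun A => \prod_(k < l) \tr (val (word_eval (tnth w k) A))).

End trace_integral.

(* The rational function [f] has no pole at [x] and takes the value [v]. *)
Definition ratfun_value (f : {fraction {poly rat}}) (x v : rat) : Prop :=
  exists p q : {poly rat},
    [/\ f = FracField.tofrac p / FracField.tofrac q, q.[x] != 0 & v = p.[x] / q.[x]].

(* Main.v *)
(* Proof.  Expanding the traces in matrix entries, one integrates out the
   matrices one at a time.  For fixed column indices, the moments
     T(i,i') = E[prod_k A(i_k,j_k) prod_k conj A(i'_k,j'_k)],  i in [n]^L, i' in [n]^L',
   intertwine U^{(x)L'} and U^{(x)L} for all unitary U, by left invariance.  This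
   is a polynomial condition on U, hence it extends to all matrices (diagonal
   ones, then normal ones by the spectral theorem, then H + i K).  If L <> L',
   scalar matrices give T = 0.  If L = L' <= n, a matrix sending e_k to e_(i'_k)
   for k < L shows that T is a combination of the tensors [i = i' o s], s in S_L.
   Contracting with these tensors and using unitarity determines the
   coefficients through the inverse of the Gram matrix of the permutation
   tensors.  This matrix is invertible for n >= L and its entries are powers of
   n, so its inverse is rational in n with no pole at n >= L.  The remaining
   sum over the indices counts solutions of systems of equations between
   variables in [n], and each such count is a power of n. *)

Require Import Defs.
From mathcomp Require Import all_boot all_order all_algebra perm fraction.
From mathcomp Require Import complex.
From mathcomp Require Import all_classical all_reals all_analysis.
From mathcomp Require Import measurable_realfun.
From mathcomp Require Import ring.
Import Order.TTheory GRing.Theory Num.Theory.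
Import numFieldNormedType.Exports.
Set Implicit Arguments.
Unset Strict Implicit.
Unset Printing Implicit Defensive.
Local Open Scope ring_scope.
Local Open Scope sesquilinear_scope.

(** * Tensors commuting with the unitary group *)

(** The entry of A^{(x)L} at the multi-indices i (row) and a (column). *)
Definition tensor_power (C : comNzRingType) n L (A : 'M[C]_n)
  (i a : {ffun 'I_L -> 'I_n}) : C := \prod_k A (i k) (a k).

Lemma tensor_powerM (C : comNzRingType) n L (A B : 'M[C]_n)
    (i a : {ffun 'I_L -> 'I_n}) :
  tensor_power (A *m B) i a =
  \sum_b tensor_power A i b * tensor_power B b a.
Proof.
rewrite /tensor_power; under eq_bigr do rewrite mxE.
rewrite bigA_distr_bigA /=; apply: eq_bigr => b _; by rewrite big_split.
Qed.

Lemma tensor_power_map (C D : comNzRingType) (f : {rmorphism C -> D}) n L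
    (A : 'M[C]_n) (i a : {ffun 'I_L -> 'I_n}) :
  tensor_power (map_mx f A) i a = f (tensor_power A i a).
Proof. by rewrite /tensor_power rmorph_prod; apply: eq_bigr => k _; rewrite mxE. Qed.

Lemma tensor_power_diag (C : comNzRingType) n L (d : 'rV[C]_n)
    (i a : {ffun 'I_L -> 'I_n}) :
  tensor_power (diag_mx d) i a = (\prod_k d 0 (i k)) *+ (i == a).
Proof.
rewrite /tensor_power; have [<-|ia] := eqVneq i a.
  by apply: eq_bigr => k _; rewrite mxE eqxx.
have /existsP[k ik] : [exists k, i k != a k].
  rewrite -negb_forall; apply: contra ia => /forallP ia.
  by apply/eqP/ffunP => k; exact/eqP.
by rewrite (bigD1 k) //= mxE (negbTE ik) mul0r.
Qed.

(** In matrix form, A^{(x)L} T = T A^{(x)L'}. *)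
Definition intertwines (C : comNzRingType) n L L'
    (T : {ffun 'I_L -> 'I_n} -> {ffun 'I_L' -> 'I_n} -> C) (A : 'M[C]_n) :=
  forall i i', \sum_a tensor_power A i a * T a i' = \sum_a T i a * tensor_power A a i'.

Lemma intertwinesM (C : comNzRingType) n L L'
    (T : {ffun 'I_L -> 'I_n} -> {ffun 'I_L' -> 'I_n} -> C) (A B : 'M[C]_n) :
  intertwines T A -> intertwines T B -> intertwines T (A *m B).
Proof.
move=> TA TB i i'.
transitivity (\sum_b tensor_power A i b * \sum_a tensor_power B b a * T a i').
  under eq_bigr do rewrite tensor_powerM mulr_suml.
  rewrite exchange_big; apply: eq_bigr => b _; rewrite mulr_sumr.
  by apply: eq_bigr => a _; rewrite mulrA.
transitivity (\sum_b (\sum_a tensor_power A i a * T a b) * tensor_power B b i').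
  under eq_bigr do rewrite TB mulr_sumr.
  rewrite exchange_big; apply: eq_bigr => b _; rewrite mulr_suml.
  by apply: eq_bigr => a _; rewrite mulrA.
under eq_bigr do rewrite TA mulr_suml.
rewrite exchange_big; apply: eq_bigr => b _; rewrite tensor_powerM mulr_sumr.
by apply: eq_bigr => a _; rewrite mulrA.
Qed.

Lemma infinitely_many_roots (R : idomainType) (p : {poly R}) (z : nat -> R) :
  injective z -> (forall k, root p (z k)) -> p = 0.
Proof.
move=> z_inj pz; apply: (@roots_geq_poly_eq0 _ p [seq z k | k <- iota 0 (size p)]).
- by apply/allP => _ /mapP[k _ ->].
- by rewrite map_inj_uniq ?iota_uniq.
- by rewrite size_map size_iota.
Qed.

(* Intertwining is a polynomial condition on the matrix. *)
Lemma intertwines_poly (C : idomainType) n L L'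
    (T : {ffun 'I_L -> 'I_n} -> {ffun 'I_L' -> 'I_n} -> C)
    (P : 'M[{poly C}]_n) (z : nat -> C) :
  injective z -> (forall k, intertwines T (map_mx (horner_eval (z k)) P)) ->
  forall t, intertwines T (map_mx (horner_eval t) P).
Proof.
move=> z_inj Tz t i i'.
pose p := \sum_a tensor_power P i a * (T a i')%:P -
          \sum_a (T i a)%:P * tensor_power P a i'.
have pE s : p.[s] =
    \sum_a tensor_power (map_mx (horner_eval s) P) i a * T a i' -
    \sum_a T i a * tensor_power (map_mx (horner_eval s) P) a i'.
  rewrite hornerD hornerN !horner_sum; congr (_ - _); apply: eq_bigr => a _;
  by rewrite hornerM hornerC tensor_power_map.
have p0 : p = 0.
  by apply: infinitely_many_roots z_inj _ => k; rewrite /root pE Tz subrr.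
by apply/eqP; rewrite -subr_eq0 -pE p0 horner0.
Qed.

(** * From unitary matrices to all matrices *)

Section unitary_extension.
Variables (C : numClosedFieldType) (n L L' : nat).
Variable T : {ffun 'I_L -> 'I_n} -> {ffun 'I_L' -> 'I_n} -> C.
Hypothesis TU : forall U : 'M[C]_n, U \is unitarymx -> intertwines T U.

(* Cayley transforms of the integers. *)
Let circle (k : nat) : C := (1 + 'i * k%:R) / (1 - 'i * k%:R).

Let circle_conj k : (1 + 'i * k%:R)^* = 1 - 'i * k%:R :> C.
Proof. by rewrite rmorphD rmorph1 rmorphM /= conjCi conjC_nat mulNr. Qed.

Let circle_num k : 1 + 'i * k%:R != 0 :> C.
Proof.
apply/eqP => /(congr1 (fun z : C => 'Re z)); rewrite raddf0 Re_rect ?rpred1 ?realn //.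
by move/eqP; rewrite oner_eq0.
Qed.

Let circle_den k : 1 - 'i * k%:R != 0 :> C.
Proof. by rewrite -circle_conj conjC_eq0. Qed.

Let circle_norm k : `|circle k| = 1.
Proof.
by rewrite normf_div -circle_conj norm_conjC divff // normr_eq0.
Qed.

Let circle_inj : injective circle.
Proof.
move=> k l /eqP; rewrite /circle eqr_div // => /eqP kl.
have : 'i * (k%:R - l%:R) * 2 = 0 :> C.
  by move/eqP: kl; rewrite -subr_eq0 => /eqP <-; ring.
move/eqP; rewrite !mulf_eq0 (negbTE (neq0Ci _)) pnatr_eq0 orbF /= subr_eq0.
by rewrite eqr_nat => /eqP.
Qed.

(** Entries below k are arbitrary, the others have modulus 1. The induction frees one entry at a
    time: with the others fixed, the condition is polynomial in entry k and holds at the infinitely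
    many points of [circle], hence for every value. *)
Let intertwines_diag_circle_prefix k (d : 'rV[C]_n) :
  (forall j : 'I_n, (k <= j)%N -> `|d 0 j| = 1) -> intertwines T (diag_mx d).
Proof.
elim: k d => [|k IHk] d d1.
  apply: TU; apply/unitarymxP; rewrite tr_diag_mx map_diag_mx mulmx_diag.
  apply/matrixP => i j; rewrite !mxE -normCK d1 ?expr1n //.
have [nk|kn] := leqP n k.
  by apply: IHk => j kj; have := leq_trans (ltn_ord j) (leq_trans nk kj); rewrite ltnn.
pose P : 'M[{poly C}]_n :=
  diag_mx (\row_j if j == k :> nat then 'X else (d 0 j)%:P).
pose e (t : C) := \row_j if j == k :> nat then t else d 0 j.
have PE t : map_mx (horner_eval t) P = diag_mx (e t).
  apply/matrixP => i j; rewrite !mxE raddfMn /= /horner_eval.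
  by case: ifP; rewrite (hornerX, hornerC).
have -> : diag_mx d = map_mx (horner_eval (d 0 (Ordinal kn))) P.
  rewrite PE; congr diag_mx; apply/rowP => j; rewrite mxE.
  by case: eqP => // jk; congr (d 0 _); apply/val_inj.
apply: intertwines_poly circle_inj _ _ => m; rewrite PE; apply: IHk => j kj.
rewrite mxE; case: eqP => [//|/eqP jk]; apply: d1.
by rewrite ltn_neqAle eq_sym jk.
Qed.

Let intertwines_diag (d : 'rV[C]_n) : intertwines T (diag_mx d).
Proof.
apply: (@intertwines_diag_circle_prefix n) => j.
by rewrite leqNgt ltn_ord.
Qed.

Let intertwines_normal (A : 'M[C]_n) : A \is normalmx -> intertwines T A.
Proof.
move=> /orthomx_spectralP ->.
apply: intertwinesM; first apply: intertwinesM => //.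
- by apply: TU; rewrite invmx_unitary ?trmxC_unitary spectral_unitarymx.
- exact/TU/spectral_unitarymx.
Qed.

Let normal_sum (H K : 'M[C]_n) (t : C) : t \is Num.real ->
  H ^t* = H -> K ^t* = K -> H + t *: K \is normalmx.
Proof.
move=> tR HH KK; apply/normalmxP.
suff -> : (H + t *: K) ^t* = H + t *: K by [].
by rewrite linearD linearZ /= map_mxD map_mxZ HH KK /= (CrealP tR).
Qed.

(* Every matrix is H + i K with H, K Hermitian, and H + t K is normal for
   real t. *)
Lemma intertwines_all (A : 'M[C]_n) : intertwines T A.
Proof.
pose H : 'M[C]_n := 2^-1 *: (A + A ^t*); pose K : 'M[C]_n := (2^-1 * - 'i) *: (A - A ^t*).
have HH : H ^t* = H.
  rewrite /H linearZ /= map_mxZ linearD /= map_mxD trmxCK addrC; congr (_ *: _).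
  by rewrite fmorphV /= conjC_nat.
have KK : K ^t* = K.
  rewrite /K linearZ /= map_mxZ linearB /= map_mxB trmxCK -opprB scalerN -scaleNr.
  by congr (_ *: _); rewrite rmorphM rmorphN /= fmorphV /= conjC_nat conjCi opprK mulrN.
have AE : A = H + 'i *: K.
  apply/matrixP => i j; rewrite !mxE; set a := A i j; set b := _^*.
  rewrite [RHS](_ : _ = 2^-1 * (a + b - 'i ^+ 2 * (a - b))); last by ring.
  by rewrite sqrCi; field.
pose P : 'M[{poly C}]_n := map_mx polyC H + 'X *: map_mx polyC K.
have PE t : map_mx (horner_eval t) P = H + t *: K.
  by apply/matrixP => i j; rewrite !mxE /horner_eval !(hornerE, hornerC).
(* The natural numbers supply infinitely many real parameters; A is the value of the pencil at
   'i. *)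
rewrite AE -PE; apply: (@intertwines_poly _ _ _ _ T P (fun k => k%:R)).
  by move=> k l /eqP; rewrite eqr_nat => /eqP.
by move=> k; rewrite PE; apply: intertwines_normal; apply: normal_sum => //; exact: realn.
Qed.

End unitary_extension.

(** The scalar matrix 2 acts on T by 2^L on one side and by 2^L' on the other. *)
Lemma intertwines_degree_neq (C : numClosedFieldType) n L L'
    (T : {ffun 'I_L -> 'I_n} -> {ffun 'I_L' -> 'I_n} -> C) :
  (forall U : 'M[C]_n, U \is unitarymx -> intertwines T U) -> L != L' ->
  forall i i', T i i' = 0.
Proof.
move=> TU LL' i i'; have /(_ i i') := @intertwines_all C n L L' T TU (diag_mx (const_mx 2)).
under eq_bigr do rewrite tensor_power_diag.
under [RHS]eq_bigr do rewrite tensor_power_diag.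
rewrite (bigD1 i) //= [X in _ + X = _]big1 ?addr0 ?eqxx; last first.
  by move=> a /negbTE ai; rewrite eq_sym ai mulr0n mul0r.
rewrite [RHS](bigD1 i') //= [X in _ = _ + X]big1 ?addr0 ?eqxx; last first.
  by move=> a /negbTE ->; rewrite mulr0n mulr0.
under eq_bigr do rewrite mxE.
under [in RHS]eq_bigr do rewrite mxE.
rewrite !mulr1n !prodr_const !card_ord mulrC => /eqP; rewrite -subr_eq0 -mulrBr mulf_eq0.
case/orP=> [/eqP //|]; rewrite subr_eq0 -!natrX eqr_nat eqn_exp2l // => LE.
by rewrite LE in LL'.
Qed.

(** * Intertwiners as combinations of permutation tensors *)

Section permutation_tensors.
Variables (C : numClosedFieldType) (n L : nat) (Ln : (L <= n)%N).
Variable T : {ffun 'I_L -> 'I_n} -> {ffun 'I_L -> 'I_n} -> C.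
Hypothesis TU : forall U : 'M[C]_n, U \is unitarymx -> intertwines T U.

Definition perm_index (i : {ffun 'I_L -> 'I_n}) (s : 'S_L) : {ffun 'I_L -> 'I_n} :=
  [ffun k => i (s k)].

(** The multi-index (0, ..., L-1), available because L <= n; its entries are distinct. *)
Let iota : {ffun 'I_L -> 'I_n} := [ffun k => widen_ord Ln k].

Let iota_inj : injective iota.
Proof. by move=> k l; rewrite !ffunE => /(congr1 val) /= /val_inj. Qed.

Let perm_iota_inj : injective (perm_index iota).
Proof.
by move=> s t /ffunP st; apply/permP => k; have := st k; rewrite !ffunE => /(congr1 val) /= /val_inj.
Qed.

Let TA := @intertwines_all C n L L T TU.

(** The diagonal projection that kills coordinate [iota k] acts as 1 on a row a avoiding the value
    [iota k], and as 0 on the column [iota]. So a nonzero entry forces a to take all L values of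
    [iota], and a has only L places. *)
Let T_iota_supp a : T a iota != 0 -> exists s, a = perm_index iota s.
Proof.
move=> Ta.
have surj k : {l | a l == iota k}.
  apply/sigW; apply/existsP; apply: contraNT Ta; rewrite negb_exists => /forallP ak.
  have := TA (diag_mx (\row_j (j != iota k)%:R)) a iota.
  under eq_bigr do rewrite tensor_power_diag.
  under [RHS]eq_bigr do rewrite tensor_power_diag.
  rewrite (bigD1 a) //= [X in _ + X = _]big1 ?addr0 ?eqxx; last first.
    by move=> b /negbTE ab; rewrite eq_sym ab mulr0n mul0r.
  rewrite [RHS](bigD1 iota) //= [X in _ = _ + X]big1 ?addr0 ?eqxx; last first.
    by move=> b /negbTE ->; rewrite mulr0n mulr0.
  rewrite [X in _ = _ * (X *+ _)](bigD1 k) //= mxE eqxx mul0r mul0rn mulr0.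
  by rewrite big1 ?mul1r => [->|l _] //; rewrite mxE ak.
pose s k := sval (surj k).
have aE k : a (s k) = iota k by apply/eqP; exact: (svalP (surj k)).
have s_inj : injective s.
  by move=> k l kl; apply: iota_inj; rewrite -!aE kl.
(* From a o s = iota it follows that a = iota o s^-1. *)
exists (perm s_inj)^-1%g; apply/ffunP => k; rewrite ffunE -aE.
by rewrite -[s _](permE s_inj) permKV.
Qed.

(* A matrix sending e_k to e_(i' k) for k < L turns the column of T at the
   injective index [iota] into the column at i'. *)
Lemma intertwines_perm_sum i i' :
  T i i' = \sum_(s : 'S_L) T (perm_index iota s) iota * (i == perm_index i' s)%:R.
Proof.
pose A : 'M[C]_n := \matrix_(b, a) [exists k, (a == iota k) && (b == i' k)]%:R.
have Aiota b k : A b (iota k) = (b == i' k)%:R.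
  rewrite mxE; congr (nat_of_bool _)%:R; apply/existsP/idP => [[l /andP[/eqP kl]]|bk].
    by rewrite (iota_inj kl).
  by exists k; rewrite eqxx.
have tA a s : tensor_power A a (perm_index iota s) = (a == perm_index i' s)%:R.
  rewrite /tensor_power; under eq_bigr do rewrite ffunE Aiota.
  have [->|ai] := eqVneq; first by rewrite big1 // => k _; rewrite ffunE eqxx.
  have /existsP[k ik] : [exists k, a k != i' (s k)].
    rewrite -negb_forall; apply: contra ai => /forallP ai.
    by apply/eqP/ffunP => k; rewrite ffunE; exact/eqP.
  by rewrite (bigD1 k) //= (negbTE ik) mul0r.
have tA1 a : tensor_power A a iota = (a == i')%:R.
  rewrite -[iota](_ : perm_index iota 1 = _); last by apply/ffunP => k; rewrite !ffunE perm1.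
  by rewrite tA; congr (_ == _)%:R; apply/ffunP => k; rewrite ffunE perm1.
have := TA A i iota.
rewrite [RHS](bigD1 i') //= [X in _ = _ + X]big1 ?addr0; last first.
  by move=> a /negbTE ai; rewrite tA1 ai mulr0.
rewrite tA1 eqxx mulr1 => <-.
(* By [T_iota_supp], only the rearrangements of [iota] contribute. *)
rewrite (bigID (mem [set perm_index iota s | s : 'S_L])) /= [X in _ + X]big1 ?addr0.
  rewrite big_imset; last by move=> s t _ _; exact: perm_iota_inj.
  rewrite big_mkcond /=; apply: eq_bigr => s _.
  by rewrite tA mulrC.
move=> a /imsetP aN; have [->|/T_iota_supp[s aE]] := eqVneq (T a iota) 0; first by rewrite mulr0.
by case: aN; exists s.
Qed.

End permutation_tensors.

(** * Counting and rational functions *)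

(** A system is a list of pairs, so that further equations are added by concatenation. *)
Definition satisfies (V : finType) (X : eqType) (v : V -> X) (E : seq (V * V)) : bool :=
  all (fun c => v c.1 == v c.2) E.

(* A system of equations between variables amounts to invariance under an
   idempotent map that selects a representative of each class of variables. *)
Lemma satisfies_retraction (V : finType) (E : seq (V * V)) :
  exists2 rho : V -> V, forall u, rho (rho u) = rho u &
    forall (X : eqType) (v : V -> X), satisfies v E = [forall u, v (rho u) == v u].
Proof.
elim: E => [|[a b] E [rho rho_id IH]].
  by exists id => // X v; apply/esym/forallP => u.
(* The new equation a = b merges two classes: the class of a takes the representative of b. *)
exists (fun u => if rho u == rho a then rho b else rho u) => [u /=|X v /=].
  by case: (boolP (rho u == rho a)) => [_|/negbTE ua]; rewrite !rho_id ?ua //; case: ifP.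
rewrite /satisfies /= -/(satisfies v E) IH; apply/andP/forallP => [[/eqP ab /forallP vr] u|vr].
  case: ifP => [/eqP ua|_]; last exact: vr.
  by rewrite (eqP (vr b)) -ab -(eqP (vr a)) -ua.
have vb : v (rho b) = v b.
  by have := vr b; case: ifP => // _ /eqP.
split.
  by have := vr a; rewrite eqxx vb eq_sym.
apply/forallP => u; have := vr u; case: ifP => // /eqP ua /eqP <-.
by have := vr (rho a); rewrite rho_id eqxx ua => /eqP ->.
Qed.

(** A solution is a free choice of one value per class, so the exponent is the number of
    representatives and does not depend on n. *)
Lemma count_solutions (V : finType) (E : seq (V * V)) :
  exists d, forall n, (0 < n)%N -> #|[set v : {ffun V -> 'I_n} | satisfies v E]| = (n ^ d)%N.
Proof.
have [rho rho_id satE] := satisfies_retraction E.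
exists #|[pred u | rho u == u]| => -[//|n] _.
transitivity #|pffun_on (ord0 : 'I_n.+1) [pred u | rho u == u] predT|; last first.
  by rewrite card_pffun_on card_ord.
(* [h] keeps the values at the representatives, which determine a solution, and puts the default
   [ord0] elsewhere, as [pffun_on] requires. *)
pose h (v : {ffun V -> 'I_n.+1}) : {ffun V -> 'I_n.+1} := [ffun u => if rho u == u then v u else ord0].
rewrite -(card_in_imset (f := h)) => [|v w]; last first.
  rewrite !inE !satE => /forallP vr /forallP wr /ffunP vw; apply/ffunP => u.
  by have := vw (rho u); rewrite !ffunE rho_id eqxx (eqP (vr u)) (eqP (wr u)).
apply: eq_card => g; apply/imsetP/pffun_onP => [[v _ ->]|[gs _]].
  split=> //; apply/fintype.subsetP => u; rewrite !inE ffunE.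
  by case: ifP => //; rewrite eqxx.
exists [ffun u => g (rho u)].
  by rewrite inE satE; apply/forallP => u; rewrite !ffunE rho_id.
apply/ffunP => u; rewrite !ffunE; case: ifP => [/eqP -> //|ru].
by apply/eqP; apply: contraFT ru => gu; move/fintype.subsetP: gs => /(_ u); apply; rewrite inE.
Qed.

(** One pair p, q serves all n in D. The absence of poles is part of the definition, so sums and
    products stay in the class without any cancellation. *)
Definition rational_on (D : pred nat) (g : nat -> rat) : Prop :=
  exists p q : {poly rat}, forall n, D n -> q.[n%:R] != 0 /\ g n = p.[n%:R] / q.[n%:R].

Section rational_on_closure.
Variable D : pred nat.

Lemma eq_rational_on (g h : nat -> rat) :
  (forall n, D n -> g n = h n) -> rational_on D g -> rational_on D h.
Proof. by move=> gh [p [q pq]]; exists p, q => n Dn; rewrite -gh //; exact: pq. Qed.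

Lemma sub_rational_on (D' : pred nat) (g : nat -> rat) :
  {subset D' <= D} -> rational_on D g -> rational_on D' g.
Proof. by move=> DD [p [q pq]]; exists p, q => n /DD; exact: pq. Qed.

Lemma rational_on_poly (p : {poly rat}) : rational_on D (fun n => p.[n%:R]).
Proof. by exists p, 1 => n _; rewrite hornerC oner_neq0 divr1. Qed.

Lemma rational_onD (g h : nat -> rat) :
  rational_on D g -> rational_on D h -> rational_on D (fun n => g n + h n).
Proof.
move=> [p [q pq]] [p' [q' pq']]; exists (p * q' + p' * q), (q * q') => n Dn.
have [q0 ->] := pq n Dn; have [q0' ->] := pq' n Dn.
by rewrite !hornerE mulf_neq0 // addf_div.
Qed.

Lemma rational_onM (g h : nat -> rat) :
  rational_on D g -> rational_on D h -> rational_on D (fun n => g n * h n).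
Proof.
move=> [p [q pq]] [p' [q' pq']]; exists (p * p'), (q * q') => n Dn.
have [q0 ->] := pq n Dn; have [q0' ->] := pq' n Dn.
by rewrite !hornerM mulf_neq0 // mulf_div.
Qed.

Lemma rational_on_sum (I : Type) (s : seq I) (g : I -> nat -> rat) :
  (forall i, rational_on D (g i)) -> rational_on D (fun n => \sum_(i <- s) g i n).
Proof.
move=> gr; elim: s => [|i s IHs].
  by apply: eq_rational_on (rational_on_poly 0) => n _; rewrite big_nil horner0.
by apply: eq_rational_on (rational_onD (gr i) IHs) => n _; rewrite big_cons.
Qed.

End rational_on_closure.

(** * The Gram matrix of the permutation tensors and its inverse *)

Section weingarten.
Variable L : nat.
Local Notation S := {perm 'I_L}.

(** The inner product of the tensors [i = v o a] and [i = v o b], as functions of the pair (i,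
    v). *)
Definition gram n : 'M[rat]_#|S| :=
  \matrix_(a, b) #|[set v : {ffun 'I_L -> 'I_n} | perm_index v (enum_val a) == perm_index v (enum_val b)]|%:R.

(** The Weingarten function of the unitary group. It has this meaning when [gram n] is invertible,
    in particular for L <= n; [invmx] returns a singular matrix unchanged. *)
Definition weingarten n (s t : S) : rat := invmx (gram n) (enum_rank s) (enum_rank t).

(* The Gram matrix of the permutation tensors, which are linearly independent:
   their columns at an injective index are distinct standard basis vectors. *)
Lemma gram_unit n : (L <= n)%N -> gram n \in unitmx.
Proof.
move=> Ln.
pose M : 'M[rat]_(#|S|, #|{: {ffun 'I_L -> 'I_n} * {ffun 'I_L -> 'I_n}}|) :=
  \matrix_(a, b) ((enum_val b).1 == perm_index (enum_val b).2 (enum_val a))%:R.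
have GE : gram n = M *m M^T.
  apply/matrixP => a b; rewrite !mxE.
  under eq_bigr do rewrite !mxE.
  rewrite -(big_enum_val (A := predT) (fun iv : {ffun 'I_L -> 'I_n} * {ffun 'I_L -> 'I_n} =>
    (iv.1 == perm_index iv.2 (enum_val a))%:R * (iv.1 == perm_index iv.2 (enum_val b))%:R)) /=.
  rewrite -(pair_bigA _ (fun i v : {ffun 'I_L -> 'I_n} =>
    (i == perm_index v (enum_val a))%:R * (i == perm_index v (enum_val b))%:R)) /= exchange_big /=.
  rewrite -sum1_card natr_sum big_mkcond /=; apply: eq_bigr => v _.
  rewrite (bigD1 (perm_index v (enum_val a))) //= eqxx mul1r big1 ?addr0.
    by rewrite inE; case: eqP.
  by move=> i /negbTE ->; rewrite mul0r.
rewrite -row_free_unit; apply: inj_row_free => x xG.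
(* x G = 0 makes x M (x M)^T vanish; this is a sum of squares of rationals. *)
have xM : x *m M = 0.
  have : (x *m M) *m (x *m M)^T = 0 by rewrite trmx_mul mulmxA -(mulmxA x) -GE xG mul0mx.
  move=> /matrixP /(_ 0 0); rewrite !mxE => /eqP.
  under eq_bigr do rewrite [_^T _ _]mxE -expr2.
  rewrite psumr_eq0 => [/allP xM|b _]; last exact: sqr_ge0.
  apply/rowP => b; have := xM b; rewrite mem_index_enum => /(_ isT).
  by rewrite implyTb sqrf_eq0 => /eqP ->; rewrite mxE.
pose iota : {ffun 'I_L -> 'I_n} := [ffun k => widen_ord Ln k].
apply/rowP => a; rewrite [RHS]mxE.
move/rowP/(_ (enum_rank (perm_index iota (enum_val a), iota))): xM.
rewrite !mxE (bigD1 a) //= !mxE enum_rankK /= eqxx mulr1 big1 ?addr0 // => b ba.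
rewrite !mxE enum_rankK /=; case: eqP => [ab|]; last by rewrite mulr0.
case/eqP: ba; apply: enum_val_inj; apply/permP => k.
by move/ffunP/(_ k): ab; rewrite !ffunE => /(congr1 val) /= /val_inj.
Qed.

(** Cramer's rule: the Gram entries are powers of n, so the matrix is the value at n of a polynomial
    matrix, whose adjugate and determinant give numerator and denominator. [gram_unit] excludes
    poles. *)
Lemma weingarten_rational (s t : S) :
  rational_on [pred n | (0 < n)%N && (L <= n)%N] (fun n => weingarten n s t).
Proof.
have Gd (ab : 'I_#|S| * 'I_#|S|) : exists d, forall n, (0 < n)%N -> gram n ab.1 ab.2 = (n ^ d)%:R.
  have [d Hd] := count_solutions [seq (enum_val ab.1 k, enum_val ab.2 k) | k <- enum 'I_L].
  exists d => n n0; rewrite mxE -Hd //; congr _%:R; apply: eq_card => v; rewrite !inE.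
  rewrite /satisfies all_map; apply/eqP/allP => [/ffunP vE k _ /=|vE].
    by have := vE k; rewrite !ffunE => ->.
  by apply/ffunP => k; rewrite !ffunE; apply/eqP/vE; rewrite mem_enum.
have [d {}Gd] := fin_all_exists Gd.
pose P : 'M[{poly rat}]_#|S| := \matrix_(a, b) 'X^(d (a, b)).
have PE n : (0 < n)%N -> map_mx (horner_eval n%:R) P = gram n.
  move=> n0; apply/matrixP => a b; rewrite [LHS]mxE [in LHS]mxE /horner_eval hornerXn.
  by rewrite (Gd (a, b)) // natrX.
exists (\adj P (enum_rank s) (enum_rank t)), (\det P) => n /andP[n0 Ln].
have detE : (\det P).[n%:R] = \det (gram n) by rewrite -PE // det_map_mx.
have uG := gram_unit Ln.
rewrite detE; split; first by move: uG; rewrite unitmxE unitfE.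
rewrite /weingarten /invmx uG mxE mulrC; congr (_ / _).
by rewrite -PE // -map_mx_adj mxE.
Qed.

End weingarten.

(** * Integration against Haar measure *)

Local Open Scope classical_set_scope.
Local Open Scope ring_scope.

(** * Measurability and boundedness of matrix entries *)

Section entries.
Variables (R : realType) (n : nat).
Local Notation C := R[i].

Lemma continuous_complex_Re : continuous (fun z : C^o => complex.Re z : R).
Proof.
move=> z B /nbhs_ballP[e /= e0 eB]; apply/nbhs_ballP.
exists (e%:C)%C => /=; first by rewrite ltcR.
move=> w; rewrite -ball_normE /= => zw; apply: eB; rewrite -ball_normE /=.
rewrite -raddfB /= -ltcR; exact: le_lt_trans (normc_ge_Re _) zw.
Qed.

Lemma continuous_complex_Im : continuous (fun z : C^o => complex.Im z : R).
Proof.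
move=> z B /nbhs_ballP[e /= e0 eB]; apply/nbhs_ballP.
exists (e%:C)%C => /=; first by rewrite ltcR.
move=> w; rewrite -ball_normE /= => zw; apply: eB; rewrite -ball_normE /=.
rewrite -raddfB /= -ltcR -normrN -ReiNIm; apply: le_lt_trans (normc_ge_Re _) _.
by rewrite normrM [X in _ * X]normc_def /= expr0n expr1n add0r sqrtr1 mulr1.
Qed.

Lemma continuous_measurable_unitary (f : unitary R n -> R) :
  continuous f -> measurable_fun [set: unitary R n] f.
Proof.
move=> /continuousP fc; apply: (measurability _ (RGenOpens.measurableE R)).
move=> _ [_ [x [y ->]] <-]; rewrite setTI.
by apply: sub_sigma_algebra; apply: fc; exact: interval_open.
Qed.

Lemma continuous_entry i j : continuous (fun A : unitary R n => (val A i j : C^o)).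
Proof.
move=> A; apply: (@continuous_comp _ _ _ (fun A : unitary R n => (val A : 'M[C^o]_n)) (fun M : 'M[C^o]_n => M i j)).
  exact: initial_continuous.
exact: coord_continuous.
Qed.

(** The topology is initial for [val], so it is enough to control the finitely many entries of g A,
    each a linear combination of entries of A. *)
Lemma continuous_unitary_mul (g : unitary R n) : continuous (fun A : unitary R n => (g * A)%g).
Proof.
apply: continuous_comp_initial => A P [/= Q QP sQP].
have gc i j : continuous (fun B : unitary R n => (\sum_k val g i k * val B k j : C^o)).
  apply: (@continuous_big C^o _ +%R 0) => [|k _]; first exact: add_continuous.
  move=> B; apply: (@cvgMl_tmp _ _ (nbhs B) (nbhs_filter B)); exact: continuous_entry.
have := @filter_forall _ _ (fun ij : 'I_n * 'I_n => [set B | Q ij.1 ij.2 ((val g *m val B) ij.1 ij.2)])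
  (nbhs A) (nbhs_filter A).
have near_ij ij : nbhs A [set B | Q ij.1 ij.2 ((val g *m val B) ij.1 ij.2)].
  have := QP ij.1 ij.2; rewrite mxE => /(gc ij.1 ij.2 A).
  by apply: (@filterS _ _ (nbhs_filter A)) => B; rewrite /= mxE.
move=> /(_ near_ij); apply: (@filterS _ _ (nbhs_filter A)) => B QB.
by apply: sQP => i j; exact: (QB (i, j)).
Qed.

Lemma measurable_unitary_mul (g : unitary R n) :
  measurable_fun [set: unitary R n] (fun A : unitary R n => (g * A)%g).
Proof.
apply: (measurability (@open (unitary R n))) => // _ [B oB <-]; rewrite setTI.
apply: sub_sigma_algebra; have /continuousP := @continuous_unitary_mul g; exact.
Qed.

(** The rows are unit vectors. This bound makes every integrand below integrable. *)
Lemma entry_norm_le1 (A : unitary R n) i j : `|val A i j| <= 1.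
Proof.
have /unitarymxP/matrixP/(_ i i) := valP A; rewrite !mxE eqxx mulr1n.
under eq_bigr do rewrite !mxE -normCK.
move=> A1; rewrite -[1](normr1 C) -ler_sqr ?nnegrE // normr1 expr1n -A1.
by rewrite (bigD1 j) //= lerDl sumr_ge0 // => k _; rewrite exprn_ge0.
Qed.

End entries.

(** * Invariance of the joint law under translation of one matrix *)

Section haar_invariance.
Variables (R : realType) (n r : nat).
Local Notation U := (unitary R n).
Local Notation Omega := (r.-tuple U).

Definition lmul_at (x : 'I_r) (g : U) (A : Omega) : Omega :=
  [tuple if y == x then (g * tnth A y)%g else tnth A y | y < r].

Lemma measurable_lmul_at x g : measurable_fun [set: Omega] (lmul_at x g).
Proof.
apply/measurable_fun_tnthP => y.
have [yx|/negbTE yx] := eqVneq y x.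
  rewrite (_ : _ \o _ = (fun A : U => (g * A)%g) \o (fun A : Omega => tnth A y)).
    by apply: measurableT_comp; [exact: measurable_unitary_mul|exact: measurable_tnth].
  by apply/funext => A /=; rewrite tnth_mktuple yx eqxx.
rewrite (_ : _ \o _ = (fun A : Omega => tnth A y)); first exact: measurable_tnth.
by apply/funext => A /=; rewrite tnth_mktuple yx.
Qed.

Definition rectangle (B : 'I_r -> set U) : set Omega := [set A | forall y, B y (tnth A y)].

Definition rectangles : set (set Omega) :=
  [set X | exists2 B, (forall y, measurable (B y)) & X = rectangle B].

Lemma rectanglesI : setI_closed rectangles.
Proof.
move=> _ _ [B mB ->] [B' mB' ->]; exists (fun y => B y `&` B' y).
  by move=> y; exact: measurableI.
by apply/seteqP; split => [A [BA BA'] y|A AB]; [split|split => y; have [] := AB y].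
Qed.

(** The product sigma-algebra is generated by coordinate preimages, and these are rectangles whose
    other sides are full. *)
Lemma measurable_rectangles : measurable = <<s rectangles >> :> set (set Omega).
Proof.
apply/seteqP; split; last first.
  apply: smallest_sub; first exact: sigma_algebra_measurable.
  move=> _ [B mB ->].
  rewrite (_ : rectangle B = \big[setI/setT]_(y < r) ((fun A : Omega => tnth A y) @^-1` B y)).
    apply: bigsetI_measurable => y _; rewrite -[X in measurable X]setTI.
    exact: measurable_tnth.
  rewrite -bigcap_seq; apply/seteqP; split => A /= AB y; first by move=> _; exact: AB.
  by apply: AB; rewrite /= mem_index_enum.
apply: smallest_sub; first exact: smallest_sigma_algebra.
rewrite -bigcup_seq; apply: bigcup_sub => y _ _ [B mB <-]; rewrite setTI.
apply: sub_sigma_algebra; exists (fun z => if z == y then B else setT).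
  by move=> z; case: ifP.
apply/seteqP; split => A /= AB; last by have := AB y; rewrite eqxx.
by move=> z; case: ifP => // /eqP ->.
Qed.

Variable nu : probability Omega R.
Hypothesis nu_haar : independent_haar nu.

(** [nu] and its pushforward agree on rectangles, where invariance of a single factor suffices;
    rectangles are stable under intersection and generate the sigma-algebra. *)
Lemma lmul_at_invariant x g (X : set Omega) : measurable X ->
  nu (lmul_at x g @^-1` X) = nu X.
Proof.
have [mu mu_haar nuE] := nu_haar.
(* [haar_probability] speaks of images of translations: the preimage under g is the image under
   g^-1. *)
have mul_preimage (B : set U) : (fun A => (g * A)%g) @^-1` B = [set (g^-1 * A)%g | A in B].
  apply/seteqP; split => A /=; first by move=> BA; exists (g * A)%g => //; rewrite mulKg.
  by move=> [A' BA' <-]; rewrite mulVKg.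
apply: (measure_unique rectangles (fun=> setT) measurable_rectangles rectanglesI _ _
  (pushforward nu (lmul_at x g)) nu).
- move=> _; exists (fun=> setT) => //; apply/seteqP; split => //.
- by rewrite bigcup_const.
- exact: measurable_lmul_at.
- move=> mlmul _ [B mB ->].
  change (nu (lmul_at x g @^-1` rectangle B) = nu (rectangle B)).
  pose B' y := if y == x then (fun A => (g * A)%g) @^-1` B y else B y.
  have -> : lmul_at x g @^-1` rectangle B = rectangle B'.
    apply/seteqP; split => A /= AB y; have := AB y; rewrite /B' tnth_mktuple;
      by case: ifP.
  rewrite !nuE //; last first.
    move=> y; rewrite /B'; case: ifP => // _; rewrite -[X in measurable X]setTI.
    exact: measurable_unitary_mul.
  apply: eq_bigr => y _; rewrite /B'; case: ifP => // _.
  by rewrite mul_preimage mu_haar.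
- by move=> mlmul _; rewrite /= /pushforward preimage_setT probability_setT ltry.
Qed.

End haar_invariance.

(** * Integrals of bounded measurable complex functions *)

Section complex_integral_theory.
Variables (R : realType) (n r : nat).
Local Notation U := (unitary R n).
Local Notation Omega := (r.-tuple U).
Local Notation C := R[i].
Variable nu : probability Omega R.

(** This class is closed under the algebraic operations and under conjugation, and its members are
    integrable for any probability. *)
Definition bounded_measurable (f : Omega -> C) : Prop :=
  [/\ measurable_fun setT (fun A => complex.Re (f A)),
      measurable_fun setT (fun A => complex.Im (f A)) &
      exists M : C, forall A, `|f A| <= M].

Lemma bounded_measurable_cst c : bounded_measurable (fun=> c).
Proof. by split; [exact: measurable_cst|exact: measurable_cst|exists `|c|]. Qed.

Lemma bounded_measurableD f g : bounded_measurable f -> bounded_measurable g ->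
  bounded_measurable (fun A => f A + g A).
Proof.
move=> [fR fI [M fM]] [gR gI [N gN]]; split.
- by under eq_fun do rewrite raddfD /=; exact: measurable_funD.
- by under eq_fun do rewrite raddfD /=; exact: measurable_funD.
- by exists (M + N) => A; apply: le_trans (ler_normD _ _) (lerD (fM A) (gN A)).
Qed.

Lemma complex_ReM (z w : C) :
  complex.Re (z * w) = complex.Re z * complex.Re w - complex.Im z * complex.Im w.
Proof. by case: z w => [a b] [c d]. Qed.

Lemma complex_ImM (z w : C) :
  complex.Im (z * w) = complex.Re z * complex.Im w + complex.Im z * complex.Re w.
Proof. by case: z w => [a b] [c d]. Qed.

Lemma bounded_measurableM f g : bounded_measurable f -> bounded_measurable g ->
  bounded_measurable (fun A => f A * g A).
Proof.
move=> [fR fI [M fM]] [gR gI [N gN]]; split.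
- under eq_fun do rewrite complex_ReM.
  by apply: measurable_funB; exact: measurable_funM.
- under eq_fun do rewrite complex_ImM.
  by apply: measurable_funD; exact: measurable_funM.
- by exists (M * N) => A; rewrite normrM ler_pM.
Qed.


Lemma bounded_measurable_conj f : bounded_measurable f ->
  bounded_measurable (fun A => Num.conj (f A)).
Proof.
move=> [fR fI [M fM]]; split.
- by rewrite (_ : (fun _ => _) = (fun A => complex.Re (f A))) //; apply/funext => A; case: (f A).
- rewrite (_ : (fun _ => _) = (fun A => - complex.Im (f A))); first exact: measurable_funN.
  by apply/funext => A; case: (f A).
- by exists M => A; rewrite norm_conjC.
Qed.

Lemma bounded_measurable_sum (I : Type) (s : seq I) (F : I -> Omega -> C) :
  (forall i, bounded_measurable (F i)) -> bounded_measurable (fun A => \sum_(i <- s) F i A).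
Proof.
move=> FM; elim: s => [|i s IHs].
  by under eq_fun do rewrite big_nil; exact: bounded_measurable_cst.
by under eq_fun do rewrite big_cons; exact: bounded_measurableD.
Qed.

Lemma bounded_measurable_prod (I : Type) (s : seq I) (F : I -> Omega -> C) :
  (forall i, bounded_measurable (F i)) -> bounded_measurable (fun A => \prod_(i <- s) F i A).
Proof.
move=> FM; elim: s => [|i s IHs].
  by under eq_fun do rewrite big_nil; exact: bounded_measurable_cst.
by under eq_fun do rewrite big_cons; exact: bounded_measurableM.
Qed.

Lemma bounded_measurable_entry x i j :
  bounded_measurable (fun A : Omega => val (tnth A x) i j).
Proof.
split; last by exists 1 => A; exact: entry_norm_le1.
- apply: (measurableT_comp (f := fun A : U => complex.Re (val A i j)) (g := fun A : Omega => tnth A x)).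
    apply: continuous_measurable_unitary => A.
    apply: (@continuous_comp _ _ _ (fun A : U => val A i j : C^o) (fun z : C^o => complex.Re z : R)).
      exact: continuous_entry.
    exact: continuous_complex_Re.
  exact: measurable_tnth.
- apply: (measurableT_comp (f := fun A : U => complex.Im (val A i j)) (g := fun A : Omega => tnth A x)).
    apply: continuous_measurable_unitary => A.
    apply: (@continuous_comp _ _ _ (fun A : U => val A i j : C^o) (fun z : C^o => complex.Im z : R)).
      exact: continuous_entry.
    exact: continuous_complex_Im.
  exact: measurable_tnth.
Qed.

Let nu_setT : nu [set: Omega] = 1%E.
Proof. exact: (probability_setT nu). Qed.

Let bounded_integrable (h : Omega -> R) (M : R) : measurable_fun setT h ->
  (forall A, `|h A| <= M) -> nu.-integrable setT (EFin \o h).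
Proof.
move=> mh hM; apply: measurable_bounded_integrable => //.
  by have := ltry (1 : R); rewrite -nu_setT.
exists M; split; first exact: num_real.
by move=> N MN A _; apply: le_trans (hM A) (ltW MN).
Qed.

Lemma integrable_Re f : bounded_measurable f ->
  nu.-integrable setT (EFin \o (fun A => complex.Re (f A))).
Proof.
(* The order of R[i] compares real parts of numbers with equal imaginary parts, so the real part of
   the complex bound is a real bound. *)
move=> [fR _ [M fM]]; apply: (bounded_integrable (M := complex.Re M) fR) => A.
have := le_trans (normc_ge_Re _) (fM A).
by rewrite lecE /= => /andP[].
Qed.

Lemma integrable_Im f : bounded_measurable f ->
  nu.-integrable setT (EFin \o (fun A => complex.Im (f A))).
Proof.
move=> [_ fI [M fM]]; apply: (bounded_integrable (M := complex.Re M) fI) => A.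
(* Re (z i) = - Im z reduces the imaginary part to the inequality for real parts. *)
have := normc_ge_Re (f A * 'i%C); rewrite ReiNIm normrN normrM.
rewrite [X in _ * X]normc_def /= expr0n expr1n add0r sqrtr1 mulr1 => /le_trans/(_ (fM A)).
by rewrite lecE /= => /andP[].
Qed.

Lemma complex_integralD f g : bounded_measurable f -> bounded_measurable g ->
  complex_integral nu (fun A => f A + g A) = complex_integral nu f + complex_integral nu g.
Proof.
move=> fM gM; rewrite /complex_integral.
under eq_Rintegral do rewrite raddfD /=.
under [X in (_ +i* X)%C = _]eq_Rintegral do rewrite raddfD /=.
rewrite !RintegralD //.
all: by [exact: integrable_Re|exact: integrable_Im].
Qed.

Lemma complex_integralZ c f : bounded_measurable f ->
  complex_integral nu (fun A => c * f A) = c * complex_integral nu f.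
Proof.
move=> fM; rewrite /complex_integral; case: c => a b.
under eq_Rintegral do rewrite complex_ReM /=.
under [X in (_ +i* X)%C = _]eq_Rintegral do rewrite complex_ImM /=.
have fR := integrable_Re fM; have fI := integrable_Im fM.
have sI c h : nu.-integrable setT (EFin \o h) -> nu.-integrable setT (EFin \o (fun A => c * h A)).
  by move=> hI; exact: (integrableZl measurableT c hI).
rewrite RintegralB ?RintegralD ?RintegralZl //; exact: sI.
Qed.

Lemma complex_integral_cst c : complex_integral nu (fun=> c) = c.
Proof.
by rewrite /complex_integral !Rintegral_cst // [fine _](congr1 fine nu_setT) /= !mulr1; case: c.
Qed.

Lemma complex_integral_sum (I : Type) (s : seq I) (F : I -> Omega -> C) :
  (forall i, bounded_measurable (F i)) ->
  complex_integral nu (fun A => \sum_(i <- s) F i A) = \sum_(i <- s) complex_integral nu (F i).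
Proof.
move=> FM; elim: s => [|i s IHs].
  by under eq_fun do rewrite big_nil; rewrite big_nil complex_integral_cst.
under eq_fun do rewrite big_cons.
by rewrite big_cons -IHs complex_integralD //; exact: bounded_measurable_sum.
Qed.

Lemma bounded_measurable_lmul_at x g f : bounded_measurable f ->
  bounded_measurable (f \o lmul_at x g).
Proof.
move=> [fR fI [M fM]]; split; last by exists M => A; exact: fM.
- exact: (measurableT_comp fR (measurable_lmul_at x g)).
- exact: (measurableT_comp fI (measurable_lmul_at x g)).
Qed.

Hypothesis nu_haar : independent_haar nu.

Lemma Rintegral_lmul_at x g (h : Omega -> R) : measurable_fun setT h ->
  nu.-integrable setT (EFin \o (h \o lmul_at x g)) ->
  \int[nu]_A h (lmul_at x g A) = \int[nu]_A h A.
Proof.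
move=> mh hI; rewrite /Rintegral; congr fine.
rewrite -[LHS](integral_pushforward (measurable_lmul_at x g) (D := setT) (f := EFin \o h)) //.
  apply: eq_measure_integral; first exact: measurable_lmul_at.
  by move=> mphi X mX _; exact: lmul_at_invariant.
exact/measurable_EFinP.
Qed.

Lemma complex_integral_lmul_at x g f : bounded_measurable f ->
  complex_integral nu (f \o lmul_at x g) = complex_integral nu f.
Proof.
move=> fM; have fgM := bounded_measurable_lmul_at x g fM; case: (fM) => fR fI _.
rewrite /complex_integral; congr (_ +i* _)%C.
- exact: (Rintegral_lmul_at fR (integrable_Re fgM)).
- exact: (Rintegral_lmul_at fI (integrable_Im fgM)).
Qed.

End complex_integral_theory.

(** * Weingarten formula *)

Lemma tensor_power1 (C : comNzRingType) n L (i a : {ffun 'I_L -> 'I_n}) :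
  tensor_power (1%:M : 'M[C]_n) i a = (i == a)%:R.
Proof.
rewrite -diag_const_mx tensor_power_diag big1 // => k _; by rewrite mxE.
Qed.

Lemma tensor_power_adjoint (C : numClosedFieldType) n L (A : 'M[C]_n) (i a : {ffun 'I_L -> 'I_n}) :
  tensor_power (A ^t*) i a = Num.conj (tensor_power A a i).
Proof. by rewrite /tensor_power rmorph_prod; apply: eq_bigr => k _; rewrite !mxE. Qed.

Lemma tensor_power_perm (C : comNzRingType) n L (A : 'M[C]_n) (i a : {ffun 'I_L -> 'I_n}) (s : 'S_L) :
  tensor_power A (perm_index i s) (perm_index a s) = tensor_power A i a.
Proof.
rewrite /tensor_power [RHS](reindex_inj (@perm_inj _ s)) /=.
by apply: eq_bigr => k _; rewrite !ffunE.
Qed.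

Section weingarten_formula.
Variables (R : realType) (n r : nat).
Local Notation U := (unitary R n).
Local Notation Omega := (r.-tuple U).
Local Notation C := R[i].
Variable nu : probability Omega R.
Hypothesis nu_haar : independent_haar nu.

Lemma tensor_power_unitary L (A : U) (b c : {ffun 'I_L -> 'I_n}) :
  \sum_i tensor_power (val A) i b * Num.conj (tensor_power (val A) i c) = (b == c)%:R.
Proof.
transitivity (tensor_power ((val A) ^t* *m val A) c b).
  by rewrite tensor_powerM; apply: eq_bigr => i _; rewrite tensor_power_adjoint mulrC.
by rewrite -(invmx_unitary (valP A)) mulVmx ?unitarymx_unit ?(valP A) // tensor_power1 eq_sym.
Qed.

Variables (x : 'I_r) (F : Omega -> C).
Hypothesis F_bm : bounded_measurable F.
Hypothesis F_inv : forall g A, F (lmul_at x g A) = F A.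

(** For fixed column indices j, j', a mixed moment of the matrix at x, viewed as a matrix in the row
    indices i, i'. [F] stands for the factors coming from the other letters. *)
Definition tensor_moment L L' (j : {ffun 'I_L -> 'I_n}) (j' : {ffun 'I_L' -> 'I_n}) i i' : C :=
  complex_integral nu (fun A => tensor_power (val (tnth A x)) i j *
    Num.conj (tensor_power (val (tnth A x)) i' j') * F A).

Lemma bounded_measurable_tensor_power L (i j : {ffun 'I_L -> 'I_n}) :
  bounded_measurable (fun A : Omega => tensor_power (val (tnth A x)) i j).
Proof. by apply: bounded_measurable_prod => k; exact: bounded_measurable_entry. Qed.

Let integrand_bm L L' (i j : {ffun 'I_L -> 'I_n}) (i' j' : {ffun 'I_L' -> 'I_n}) :
  bounded_measurable (fun A : Omega => tensor_power (val (tnth A x)) i j *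
    Num.conj (tensor_power (val (tnth A x)) i' j') * F A).
Proof.
apply: bounded_measurableM => //; apply: bounded_measurableM.
  exact: bounded_measurable_tensor_power.
by apply: bounded_measurable_conj; exact: bounded_measurable_tensor_power.
Qed.

(** Both sides are integrals of one auxiliary function [k], taken before and after the translation A
    -> V A. *)
Lemma intertwines_tensor_moment L L' (j : {ffun 'I_L -> 'I_n}) (j' : {ffun 'I_L' -> 'I_n})
    (V : 'M[C]_n) : V \is unitarymx -> intertwines (tensor_moment j j') V.
Proof.
move=> VU i i'; pose g : U := Sub V VU.
(* The adjoint of V stands in the conjugated factor only. Expanding it gives the right side; after
   translation it cancels V there, and the V left in the first factor gives the left side. *)
pose k (A : Omega) := tensor_power (val (tnth A x)) i j *
  Num.conj (tensor_power (V ^t* *m val (tnth A x)) i' j') * F A.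
have kE : k = fun A => \sum_a tensor_power V a i' *
    (tensor_power (val (tnth A x)) i j * Num.conj (tensor_power (val (tnth A x)) a j') * F A).
  apply/funext => A; rewrite /k tensor_powerM rmorph_sum /= mulr_sumr mulr_suml; apply: eq_bigr => a _.
  by rewrite rmorphM /= tensor_power_adjoint conjCK; ring.
transitivity (complex_integral nu (k \o lmul_at x g)).
  rewrite (_ : k \o _ = fun A => \sum_a tensor_power V i a *
    (tensor_power (val (tnth A x)) a j * Num.conj (tensor_power (val (tnth A x)) i' j') * F A)).
    rewrite complex_integral_sum => [|a]; last first.
      by apply: bounded_measurableM => //; exact: bounded_measurable_cst.
    by apply: eq_bigr => a _; rewrite complex_integralZ.
  apply/funext => A; rewrite /k /= F_inv tnth_mktuple eqxx /=.
  rewrite mulmxA -(invmx_unitary VU) mulVmx ?unitarymx_unit // mul1mx.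
  rewrite tensor_powerM !mulr_suml; apply: eq_bigr => a _; ring.
rewrite complex_integral_lmul_at //; last first.
  rewrite kE; apply: bounded_measurable_sum => a.
  by apply: bounded_measurableM => //; exact: bounded_measurable_cst.
rewrite kE complex_integral_sum => [|a]; last first.
  by apply: bounded_measurableM => //; exact: bounded_measurable_cst.
by apply: eq_bigr => a _; rewrite complex_integralZ // mulrC.
Qed.

Lemma tensor_moment_degree_neq L L' (j : {ffun 'I_L -> 'I_n}) (j' : {ffun 'I_L' -> 'I_n}) i i' :
  L != L' -> tensor_moment j j' i i' = 0.
Proof. by move=> LL'; exact: (intertwines_degree_neq (intertwines_tensor_moment j j')). Qed.

(** Moving t from the rows to the columns turns the sum over i into an inner product of columns of
    A^{(x)L}, which are orthonormal. *)
Lemma tensor_moment_contract L (j j' : {ffun 'I_L -> 'I_n}) (t : 'S_L) :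
  \sum_i tensor_moment j j' (perm_index i t) i =
  (j == perm_index j' t)%:R * complex_integral nu F.
Proof.
rewrite -complex_integral_sum // -complex_integralZ //.
congr complex_integral; apply/funext => A.
rewrite -mulr_suml; congr (_ * _).
pose b := perm_index j t^-1.
have -> : j = perm_index b t by apply/ffunP => k; rewrite !ffunE permK.
under eq_bigr do rewrite tensor_power_perm.
rewrite tensor_power_unitary; congr (_ : bool)%:R; apply/eqP/eqP => [->//|/ffunP bj].
by apply/ffunP => k; have := bj (t^-1%g k); rewrite !ffunE permKV.
Qed.

(** The moment is a combination of permutation tensors; its coefficients solve a linear system with
    the Gram matrix. That matrix has rational entries, hence the factor [ratr]. *)
Lemma weingarten_formula L (i i' j j' : {ffun 'I_L -> 'I_n}) : (L <= n)%N ->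
  tensor_moment j j' i i' =
  ratr (\sum_(s : 'S_L) \sum_(t : 'S_L) weingarten n t s *
    ((i == perm_index i' s) && (j == perm_index j' t))%:R) * complex_integral nu F.
Proof.
move=> Ln.
pose iota : {ffun 'I_L -> 'I_n} := [ffun k => widen_ord Ln k].
pose c s := tensor_moment j j' (perm_index iota s) iota.
have TE a a' : tensor_moment j j' a a' = \sum_s c s * (a == perm_index a' s)%:R.
  exact: (intertwines_perm_sum Ln (intertwines_tensor_moment j j')).
pose I := complex_integral nu F.
pose G : 'M[C]_#|{perm 'I_L}| := map_mx ratr (gram L n).
pose cv : 'rV[C]_#|{perm 'I_L}| := \row_a c (enum_val a).
pose bv : 'rV[C]_#|{perm 'I_L}| := \row_b ((j == perm_index j' (enum_val b))%:R * I).
(* Contracting the expansion [TE] with every permutation gives the system c G = b. *)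
have cG : cv *m G = bv.
  apply/rowP => b; rewrite !mxE -tensor_moment_contract.
  under [RHS]eq_bigr do rewrite TE.
  rewrite exchange_big /= [RHS](big_enum_val (A := predT)).
 apply: eq_bigr => a _; rewrite !mxE ratr_nat -mulr_sumr; congr (_ * _).
  rewrite -sum1_card natr_sum big_mkcond /=; apply: eq_bigr => v _.
  by rewrite inE eq_sym; case: eqP.
have uG : G \in unitmx by rewrite map_unitmx gram_unit.
have cE s : c s = \sum_t (j == perm_index j' t)%:R * I * ratr (weingarten n t s).
  have -> : c s = cv 0 (enum_rank s) by rewrite mxE enum_rankK.
  rewrite -[cv](mulmxK uG) cG /G -map_invmx mxE.
  rewrite [RHS](reindex_onto enum_val enum_rank) /=; last by move=> t _; rewrite enum_rankK.
  apply: eq_big => [b|b _]; first by rewrite enum_valK eqxx.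
  by rewrite !mxE /weingarten enum_valK.
rewrite TE rmorph_sum /= mulr_suml; apply: eq_bigr => s _.
rewrite -/(c s) cE rmorph_sum /= !mulr_suml; apply: eq_bigr => t _.
by rewrite rmorphM /= rmorph_nat -mulnb natrM /I; ring.
Qed.
End weingarten_formula.

(** * Traces of words as sums over indices *)

(** The factors come from an infinite sequence, so that words of different lengths can be padded to
    the same m. *)
Fixpoint mxprod (C : nzRingType) n (B : nat -> 'M[C]_n) m : 'M[C]_n :=
  if m is m'.+1 then B 0%N *m mxprod (fun t => B t.+1) m' else 1%:M.

Definition ffun_cons (X : Type) m (a : X) (v : {ffun 'I_m -> X}) : {ffun 'I_m.+1 -> X} :=
  [ffun u => if unlift ord0 u is Some u' then v u' else a].

Lemma ffun_cons0 (X : Type) m (a : X) (v : {ffun 'I_m -> X}) : ffun_cons a v ord0 = a.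
Proof. by rewrite ffunE unlift_none. Qed.

Lemma ffun_consS (X : Type) m (a : X) (v : {ffun 'I_m -> X}) k :
  ffun_cons a v (lift ord0 k) = v k.
Proof. by rewrite ffunE liftK. Qed.

Lemma big_ffun_cons (V : nmodType) (X : finType) m (G : {ffun 'I_m.+1 -> X} -> V) :
  \sum_v G v = \sum_a \sum_(v : {ffun 'I_m -> X}) G (ffun_cons a v).
Proof.
rewrite pair_bigA /=; apply: reindex => /=.
exists (fun v : {ffun 'I_m.+1 -> X} => (v ord0, [ffun k => v (lift ord0 k)])) => [[a v]|v] _ /=.
  rewrite ffun_cons0; congr pair; apply/ffunP => k; by rewrite ffunE ffun_consS.
by apply/ffunP => u; rewrite ffunE; case: unliftP => [k ->|->]; rewrite ?ffunE.
Qed.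

(** A sum over index paths from i to j: m factors, m+1 vertices. The induction splits off the first
    vertex. *)
Lemma mxprodE (C : nzRingType) n m (B : nat -> 'M[C]_n) i j :
  mxprod B m i j = \sum_(v : {ffun 'I_m.+1 -> 'I_n})
    ((v ord0 == i) && (v ord_max == j))%:R *
    \prod_(t < m) B t (v (widen_ord (leqnSn m) t)) (v (lift ord0 t)).
Proof.
elim: m B i => [|m IHm] B i /=.
  rewrite mxE big_ffun_cons (bigD1 i) //= [X in _ + X]big1 ?addr0 => [|a ai]; last first.
    by rewrite big1 // => v _; rewrite ffun_cons0 (negbTE ai) mul0r.
  rewrite (big_pred1 [ffun k : 'I_0 => i]) => [|v]; last by apply/esym/eqP/ffunP => -[].
  by rewrite (_ : ord_max = ord0) ?ffun_cons0 ?eqxx ?big_ord0 ?mulr1 //; exact/val_inj.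
rewrite mxE big_ffun_cons.
rewrite [RHS](bigD1 i) //= [X in _ + X]big1 ?addr0 => [|a ai]; last first.
  by rewrite big1 // => v _; rewrite ffun_cons0 (negbTE ai) mul0r.
under eq_bigr do rewrite IHm mulr_sumr.
rewrite exchange_big /=; apply: eq_bigr => v _.
rewrite (bigD1 (v ord0)) //= [X in _ + X]big1 ?addr0 => [|a av]; last first.
  by rewrite eq_sym (negbTE av) mul0r mulr0.
rewrite ffun_cons0 !eqxx /= big_ord_recl (_ : ord_max = lift ord0 ord_max); last exact/val_inj.
rewrite !ffun_consS.
have -> : widen_ord (leqnSn m.+1) ord0 = ord0 by exact/val_inj.
rewrite ffun_cons0; case: (v ord_max == j); rewrite ?mul1r ?mul0r ?mulr0 //.
congr (_ * _); apply: eq_bigr => t _; rewrite ffun_consS.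
by have -> : widen_ord (leqnSn m.+1) (lift ord0 t) = lift ord0 (widen_ord (leqnSn m) t);
  [exact/val_inj|rewrite ffun_consS].
Qed.

Section words.
Variables (R : realType) (n r : nat).
Local Notation U := (unitary R n).
Local Notation Omega := (r.-tuple U).
Local Notation C := R[i].

(** [None] is the padding letter. Inverses are written as adjoints, so that only entries and
    conjugate entries occur. *)
Definition letter_mx (A : Omega) (a : option ('I_r * bool)) : 'M[C]_n :=
  match a with
  | None => 1%:M
  | Some (x, true) => val (tnth A x)
  | Some (x, false) => (val (tnth A x)) ^t*
  end.

Lemma mxprod_word (A : Omega) (s : seq ('I_r * bool)) m : (size s <= m)%N ->
  mxprod (fun t => letter_mx A (nth None [seq Some a | a <- s] t)) m =
  val (\prod_(a <- s) (if a.2 then tnth A a.1 else (tnth A a.1)^-1))%g.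
Proof.
elim: m s => [|m IHm] [|a s] //= sm; rewrite ?big_nil ?big_cons //.
  rewrite mul1mx; have := IHm [::] isT; rewrite big_nil => <-.
  by congr mxprod; apply/funext => t; rewrite nth_nil.
rewrite IHm //=; congr (_ *m _).
by case: a => x [] //=; rewrite (invmx_unitary (valP (tnth A x))).
Qed.

End words.

(** * Integration of index sums with labelled positions *)

Section diagram.
Variables (R : realType) (r : nat) (var pos : finType).
Variables (lab : pos -> option ('I_r * bool)) (src dst : pos -> var).
Variable E : seq (var * var).
Local Notation C := R[i].

(** [var] names the summation indices and [E] the identifications among them; each position
    contributes one matrix entry, with row [src] and column [dst]. *)
Definition diagram n (A : r.-tuple (unitary R n)) : C :=
  \sum_(v : {ffun var -> 'I_n}) (satisfies v E)%:R *
    \prod_p letter_mx A (lab p) (v (src p)) (v (dst p)).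

Definition occ (x : 'I_r) (b : bool) := [pred p | lab p == Some (x, b)].

(** Entries of the identity are Kronecker deltas, hence equations between variables. *)
Definition trivial_eqs : seq (var * var) :=
  [seq (src p, dst p) | p <- enum pos & lab p == None].

(** All entries of the matrix at x. For inverse letters the adjoint exchanges row and column. *)
Definition labelled_factor n (v : {ffun var -> 'I_n}) x (A : r.-tuple (unitary R n)) : C :=
  (\prod_(p in occ x true) val (tnth A x) (v (src p)) (v (dst p))) *
  (\prod_(p in occ x false) Num.conj (val (tnth A x) (v (dst p)) (v (src p)))).

Lemma prod_letters n (A : r.-tuple (unitary R n)) (v : {ffun var -> 'I_n}) :
  \prod_p letter_mx A (lab p) (v (src p)) (v (dst p)) =
  (satisfies v trivial_eqs)%:R * \prod_x labelled_factor v x A.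
Proof.
(* The share of position p in the factor of x with sign b, equal to 1 unless p has exactly that
   label; the products over p and x can then be exchanged. *)
pose h (b : bool) x p : C := if p \in occ x b then
    if b then val (tnth A x) (v (src p)) (v (dst p))
    else Num.conj (val (tnth A x) (v (dst p)) (v (src p))) else 1.
have hE p : letter_mx A (lab p) (v (src p)) (v (dst p)) =
    (if lab p == None then (v (src p) == v (dst p))%:R else 1) *
    \prod_x (h true x p * h false x p).
  under eq_bigr do rewrite /h !inE /=.
  case: (lab p) => [[y b]|] /=; last by rewrite mxE big1 ?mulr1 // => x _; rewrite mulr1.
  rewrite mul1r (bigD1 y) //= big1 ?mulr1 => [|x xy]; last first.
    by rewrite /eq_op /= /eq_op /= eq_sym (negbTE xy) mulr1.
  rewrite /eq_op /= /eq_op /= eqxx; case: b => /=; first by rewrite mulr1.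
  by rewrite mul1r !mxE.
under eq_bigr do rewrite hE.
rewrite big_split exchange_big /=; congr (_ * _); last first.
  by apply: eq_bigr => x _; rewrite big_split /labelled_factor -!big_mkcond.
rewrite /satisfies /trivial_eqs all_map all_filter.
have [/allP vE|/allPn[p _]] := boolP (all _ _).
  rewrite big1 // => p _; case: ifP => // lp.
  by have := vE p; rewrite mem_enum => /(_ isT) /implyP /(_ lp) /= ->.
rewrite /= negb_imply /= => /andP[lp vp].
by rewrite (bigD1 p) //= lp (negbTE vp) mul0r.
Qed.

(** The degrees enter through equations so that, for balanced letters, both tensor powers can be
    indexed by the same ['I_L]. *)
Lemma labelled_factor_tensor n (v : {ffun var -> 'I_n}) x (A : r.-tuple (unitary R n))
    L L' (eL : L = #|occ x true|) (eL' : L' = #|occ x false|) :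
  let e k := enum_val (cast_ord eL k) in let e' k := enum_val (cast_ord eL' k) in
  labelled_factor v x A =
  tensor_power (val (tnth A x)) [ffun k => v (src (e k))] [ffun k => v (dst (e k))] *
  Num.conj (tensor_power (val (tnth A x)) [ffun k => v (dst (e' k))] [ffun k => v (src (e' k))]).
Proof.
move=> e e'; rewrite {}/e {}/e'; subst L L'.
rewrite /labelled_factor (big_enum_val (A := occ x true)) (big_enum_val (A := occ x false)) /=.
  rewrite /tensor_power rmorph_prod /=.
by congr (_ * _); apply: eq_bigr => k _; rewrite !ffunE cast_ord_id.
Qed.

Lemma bounded_measurable_labelled_factor n (v : {ffun var -> 'I_n}) x :
  bounded_measurable (labelled_factor v x : r.-tuple (unitary R n) -> C).
Proof.
rewrite -[labelled_factor v x]/(fun A => labelled_factor v x A).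
under eq_fun do rewrite (labelled_factor_tensor v _ (erefl #|occ x true|) (erefl #|occ x false|)).
apply: bounded_measurableM; first exact: bounded_measurable_tensor_power.
by apply: bounded_measurable_conj; exact: bounded_measurable_tensor_power.
Qed.

Lemma labelled_factor_lmul_at n (v : {ffun var -> 'I_n}) x y g (A : r.-tuple (unitary R n)) :
  y != x -> labelled_factor v y (lmul_at x g A) = labelled_factor v y A.
Proof. by move=> /negbTE yx; rewrite /labelled_factor tnth_mktuple yx. Qed.

Section integral.
Variables (n : nat) (nu : probability (r.-tuple (unitary R n)) R).
Hypothesis nu_haar : independent_haar nu.

Lemma integral_diagram : complex_integral nu (@diagram n) =
  \sum_(v : {ffun var -> 'I_n}) (satisfies v (trivial_eqs ++ E))%:R *
     complex_integral nu (fun A => \prod_x labelled_factor v x A).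
Proof.
have bm v : bounded_measurable (fun A : r.-tuple (unitary R n) => \prod_x labelled_factor v x A).
  by apply: bounded_measurable_prod => x; exact: bounded_measurable_labelled_factor.
rewrite (_ : @diagram n = fun A => \sum_(v : {ffun var -> 'I_n}) (satisfies v (trivial_eqs ++ E))%:R *
     \prod_x labelled_factor v x A); last first.
  apply/funext => A; apply: eq_bigr => v _; rewrite prod_letters mulrA; congr (_ * _).
  by rewrite /satisfies all_cat mulrC -natrM mulnb.
rewrite complex_integral_sum => [|v]; last first.
  by apply: bounded_measurableM => //; exact: bounded_measurable_cst.
by apply: eq_bigr => v _; rewrite complex_integralZ.
Qed.

(** The factors of the other letters do not see translations at x, so this is a moment of unequal
    degrees. *)
Lemma integral_unbalanced (v : {ffun var -> 'I_n}) x : #|occ x true| != #|occ x false| ->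
  complex_integral nu (fun A => \prod_y labelled_factor v y A) = 0.
Proof.
move=> bal; pose F (A : r.-tuple (unitary R n)) := \prod_(y | y != x) labelled_factor v y A.
have F_bm : bounded_measurable F.
  rewrite /F; under eq_fun do rewrite -big_filter.
  by apply: bounded_measurable_prod => y; exact: bounded_measurable_labelled_factor.
have F_inv g A : F (lmul_at x g A) = F A.
  by apply: eq_bigr => y yx; rewrite labelled_factor_lmul_at.
under eq_fun do rewrite (bigD1 x) //=
  (labelled_factor_tensor v _ (erefl #|occ x true|) (erefl #|occ x false|)).
exact: (tensor_moment_degree_neq nu_haar F_bm F_inv).
Qed.

End integral.

Hypothesis balanced : forall x, #|occ x true| = #|occ x false|.

Let e x (k : 'I_#|occ x true|) : pos := enum_val k.
Let e' x (k : 'I_#|occ x true|) : pos := enum_val (cast_ord (balanced x) k).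

(** The conditions i = i' o s on rows and j = j' o t on columns. At inverse letters the row is [dst]
    and the column is [src]. *)
Definition gluing_eqs x (s t : {perm 'I_#|occ x true|}) : seq (var * var) :=
  [seq (src (e k), dst (e' (s k))) | k <- enum 'I_#|occ x true|] ++
  [seq (dst (e k), src (e' (t k))) | k <- enum 'I_#|occ x true|].

Definition factor_value n (v : {ffun var -> 'I_n}) x : rat :=
  \sum_s \sum_t weingarten n t s * (satisfies v (gluing_eqs (x := x) s t))%:R.

(** [weingarten_formula] integrates out one letter at a time, with the product over the remaining
    letters as [F]. *)
Lemma integral_balanced n (nu : probability (r.-tuple (unitary R n)) R) (v : {ffun var -> 'I_n}) :
  independent_haar nu -> (forall x, #|occ x true| <= n)%N ->
  complex_integral nu (fun A => \prod_x labelled_factor v x A) =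
  ratr (\prod_x factor_value v x).
Proof.
(* The list of letters is kept duplicate-free, so that translating the head letter leaves the
   factors of the tail unchanged. *)
move=> nu_haar occn; rewrite /index_enum; move: (enum_uniq 'I_r); rewrite enumT.
elim: Finite.enum => [|x s IHs] /=.
  by under eq_fun do rewrite big_nil; rewrite big_nil complex_integral_cst rmorph1.
move=> /andP[xs us]; rewrite big_cons rmorphM /= -IHs //.
under eq_fun do rewrite big_cons (labelled_factor_tensor v _ (erefl #|occ x true|) (balanced x)).
have F_bm : bounded_measurable (fun A : r.-tuple (unitary R n) => \prod_(y <- s) labelled_factor v y A).
  by apply: bounded_measurable_prod => y; exact: bounded_measurable_labelled_factor.
rewrite [LHS](weingarten_formula nu_haar F_bm) //; last first.
  move=> g A; apply: eq_big_seq => y ys; rewrite labelled_factor_lmul_at //.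
  by apply: contraNneq xs => <-.
congr (ratr _ * _); apply: eq_bigr => p _; apply: eq_bigr => q _; congr (_ * (nat_of_bool _)%:R).
rewrite /satisfies all_cat; congr (_ && _); rewrite all_map.
- apply/eqP/allP => [/ffunP vE k _ /=|vE]; first by have := vE k; rewrite !ffunE cast_ord_id => ->.
  by apply/ffunP => k; rewrite !ffunE cast_ord_id; apply/eqP/(vE k); rewrite mem_enum.
- apply/eqP/allP => [/ffunP vE k _ /=|vE]; first by have := vE k; rewrite !ffunE cast_ord_id => ->.
  by apply/ffunP => k; rewrite !ffunE cast_ord_id; apply/eqP/(vE k); rewrite mem_enum.
Qed.

(** Induction on the letters with [E'] general: expanding the factor of a letter moves its gluing
    equations into the system, with a Weingarten coefficient. Without letters, a count of solutions
    n^d remains. *)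
Lemma factor_sum_rational (E' : seq (var * var)) :
  rational_on [pred n | (0 < n)%N && [forall x, #|occ x true| <= n]%N]
    (fun n => \sum_(v : {ffun var -> 'I_n}) (satisfies v E')%:R * \prod_x factor_value v x).
Proof.
elim: (index_enum _) E' => [|x s IHs] E'.
  have [d Hd] := count_solutions E'.
  apply: eq_rational_on (rational_on_poly _ 'X^d) => n /andP[n0 _].
  rewrite hornerXn -natrX -Hd // -sum1_card natr_sum big_mkcond /=.
  by apply: eq_bigr => v _; rewrite inE big_nil mulr1; case: satisfies.
have Dx : {subset [pred n | (0 < n)%N && [forall x, #|occ x true| <= n]%N]
    <= [pred n | (0 < n)%N && (#|occ x true| <= n)%N]}.
  by move=> n /andP[n0 /forallP occn]; rewrite inE n0 occn.
have xr p q := rational_onM (sub_rational_on Dx (weingarten_rational q p))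
  (IHs (E' ++ gluing_eqs (x := x) p q)).
have := rational_on_sum (index_enum _) (fun p => rational_on_sum (index_enum _) (fun q => xr p q)).
apply: eq_rational_on => n _.
under [RHS]eq_bigr do rewrite big_cons /factor_value mulrCA mulr_suml.
rewrite [RHS]exchange_big /=; apply: eq_bigr => p _.
under [RHS]eq_bigr do rewrite mulr_suml.
rewrite [RHS]exchange_big /=; apply: eq_bigr => q _.
rewrite mulr_sumr; apply: eq_bigr => v _.
by rewrite /satisfies all_cat -mulnb natrM; ring.
Qed.

End diagram.

(** * The diagram of a tuple of words *)

Section word_diagram.
Variables (r l : nat) (w : l.-tuple (free_group r)).

Definition max_word_size := \max_(k < l) size (val (tnth w k)).
Local Notation m := max_word_size.

(* All words are padded with trivial letters to a common length m; the word k
   uses the variables (k, 0), ..., (k, m), of which the first and the last are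
   identified. *)
Definition word_var : finType := ('I_l * 'I_m.+1)%type.
Definition word_pos : finType := ('I_l * 'I_m)%type.
Definition word_lab (p : word_pos) : option ('I_r * bool) :=
  nth None [seq Some a | a <- val (tnth w p.1)] p.2.
Definition word_src (p : word_pos) : word_var := (p.1, widen_ord (leqnSn m) p.2).
Definition word_dst (p : word_pos) : word_var := (p.1, lift ord0 p.2).
Definition word_eqs : seq (word_var * word_var) :=
  [seq ((k, ord0), (k, ord_max)) | k <- enum 'I_l].

(** Each trace is a sum over closed index paths of length m; the product of these sums is one sum
    over families of paths. *)
Lemma prod_trace_diagram (R : realType) n (A : r.-tuple (unitary R n)) :
  \prod_(k < l) \tr (val (word_eval (tnth w k) A)) =
  diagram word_lab word_src word_dst word_eqs A.
Proof.
pose G k (v : {ffun 'I_m.+1 -> 'I_n}) : R[i] := (v ord0 == v ord_max)%:R *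
  \prod_(t < m) letter_mx A (word_lab (k, t)) (v (widen_ord (leqnSn m) t)) (v (lift ord0 t)).
have trE k : \tr (val (word_eval (tnth w k) A)) = \sum_v G k v.
  rewrite -(mxprod_word A (m := m)); last exact: (leq_bigmax k).
  rewrite /mxtrace; under eq_bigr do rewrite mxprodE.
  rewrite exchange_big /=; apply: eq_bigr => v _; rewrite -mulr_suml; congr (_ * _).
  rewrite (bigD1 (v ord0)) //= big1 ?addr0 => [|i iv].
    by rewrite eqxx eq_sym.
  by rewrite eq_sym (negbTE iv).
under eq_bigr do rewrite trE.
rewrite bigA_distr_bigA /= /diagram.
(* A family of paths is the same as one assignment on the pairs (k, t). *)
rewrite [RHS](reindex (fun V : {ffun 'I_l -> {ffun 'I_m.+1 -> 'I_n}} =>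
  [ffun kt : word_var => V kt.1 kt.2])) /=; last first.
  exists (fun v => [ffun k => [ffun t => v (k, t)]]) => [V _|v _].
    by apply/ffunP => k; apply/ffunP => t; rewrite !ffunE.
  by apply/ffunP => -[k t]; rewrite !ffunE.
apply: eq_bigr => V _; rewrite /G big_split /=; congr (_ * _); last first.
  rewrite pair_bigA /=; apply: eq_bigr => -[k t] _ /=.
  by rewrite !ffunE.
rewrite /satisfies all_map.
have [/allP VE|/allPn[k _ kV]] := boolP (all _ _).
  by rewrite big1 // => k _; have := VE k; rewrite mem_enum /= !ffunE => /(_ isT) ->.
by rewrite (bigD1 k) //=; move: kV; rewrite /= !ffunE /= => /negbTE ->; rewrite mul0r.
Qed.

(** Padding adds no occurrences, so the degree in the Weingarten formula is the number L_x bounding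
    n. *)
Lemma card_occ_word x : #|occ word_lab x true| = pos_occurrences w x.
Proof.
rewrite -sum1_card big_mkcond /= /pos_occurrences.
rewrite -(pair_bigA _ (fun k t => if (k, t) \in occ word_lab x true then 1 else 0)%N) /=.
apply: eq_bigr => k _.
set s := val (tnth w k); have sm : (size s <= m)%N by exact: (leq_bigmax k).
transitivity (\sum_(0 <= t < m) (nth None [seq Some a | a <- s] t == Some (x, true)))%N.
  by rewrite big_mkord; apply: eq_bigr => t _; rewrite inE /word_lab -/s; case: eqP.
rewrite (big_cat_nat _ sm) //= [X in (_ + X)%N]big_nat [X in (_ + X)%N]big1 ?addn0 => [|t /andP[st _]]; last first.
  by rewrite nth_default ?size_map.
rewrite -sum1_count [RHS]big_mkcond (big_nth (x, true)) !big_mkord.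
by apply: eq_bigr => t _; rewrite (nth_map (x, true)) //= /eq_op /=; case: eqP.
Qed.

End word_diagram.

(** * Rationality of the trace integrals *)

Theorem proposition1p1 (R : realType) (r l : nat) (hl : (0 < l)%N)
    (w : l.-tuple (free_group r)) :
  exists f : {fraction {poly rat}},
    forall n : nat, (0 < n)%N ->
      (\max_(x < r) pos_occurrences w x <= n)%N ->
      forall nu : probability (r.-tuple (unitary R n)) R,
        independent_haar nu ->
        exists2 v : rat, ratfun_value f n%:R v & trace_integral nu w = ratr v.
Proof.
pose lab := @word_lab r l w.
have intE n (nu : probability (r.-tuple (unitary R n)) R) :
    trace_integral nu w = complex_integral nu
      (diagram (n := n) lab (@word_src r l w) (@word_dst r l w) (word_eqs w)).
  by congr complex_integral; apply/funext => A; rewrite prod_trace_diagram.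
have [/forallP bal|] := boolP [forall x, #|occ lab x true| == #|occ lab x false|]; last first.
  rewrite negb_forall => /existsP[x xbal].
  (* A letter occurring unequally often with the two signs makes the integral vanish for every n. *)
  exists 0 => n _ _ nu nu_haar; exists 0.
    by exists 0, 1; rewrite rmorph0 mul0r hornerC oner_neq0 horner0 mul0r.
  rewrite intE integral_diagram // big1 ?rmorph0 // => v _.
  by rewrite (integral_unbalanced _ _ nu_haar v xbal) mulr0.
have {}bal x := eqP (bal x).
(* [p] and [q] are fixed before n and the law are introduced. *)
have [p [q pq]] := factor_sum_rational (@word_src r l w) (@word_dst r l w) bal
  (trivial_eqs lab (@word_src r l w) (@word_dst r l w) ++ word_eqs w).
exists (FracField.tofrac p / FracField.tofrac q) => n n0 occn nu nu_haar.
have {}occn x : (#|occ lab x true| <= n)%N.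
  by rewrite card_occ_word; apply: leq_trans occn; exact: (leq_bigmax x).
have [|q0 gE] := pq n; first by rewrite /= n0; apply/forallP.
exists (p.[n%:R] / q.[n%:R]); first by exists p, q.
rewrite intE integral_diagram // -gE rmorph_sum /=; apply: eq_bigr => v _.
by rewrite (integral_balanced _ _ bal) // rmorphM /= rmorph_nat.
Qed.
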